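(* Assume $Q=q^2$ with $q$ an odd prime power. Let $m=1$, $J=L=\{1\}$ and $N_1=2(q-1)+1$. Take $r\le q-2$ consecutive integers $\boldsymbol{a}_1=0,\boldsymbol{a}_2=1,\dots,\boldsymbol{a}_r=r-1$, and let $\Delta=\bigcup_{l=1}^r\mathfrak{I}_{\boldsymbol{a}_l}$. Then the subfield-subcode $\mathcal{C}^J_\Delta$ over $\mathbb{F}_q$ has length $n_J=2(q-1)$, dimension $k=2r-\lceil\frac r2\rceil$ and minimum distance $d\ge(q-1)-2\lfloor\frac{r-2}{2}\rfloor$. It is a sharp LRC code with locality $(r,q-r)$ and $(q-r-1)$-th LRC-Singleton defect $$D_{q-r-1}\le\left\lceil\frac r2\right\rceil+2\left\lfloor\frac{r-2}{2}\right\rfloor+1-r .$$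
   Context: **Codes (case $m=1$, $J=\{1\}$).** Let $N_1>1$ with $N_1-1$ dividing $Q-1$, and let $Z_J=\{P_1,\dots,P_{n_J}\}\subset\mathbb{F}_Q$ be the set of roots of $X^{N_1-1}-1$, so $n_J=N_1-1$. Put $\mathcal{H}_J=\{0,1,\dots,N_1-2\}$, identified with $\mathbb{Z}/(N_1-1)\mathbb{Z}$. For non-empty $\Delta\subseteq\mathcal{H}_J$, $E^J_\Delta\subseteq\mathbb{F}_Q^{n_J}$ is the $\mathbb{F}_Q$-span of the vectors $(P_1^a,\dots,P_{n_J}^a)$, $a\in\Delta$, and the subfield-subcode over $\mathbb{F}_q$ is $\mathcal{C}^J_\Delta=E^J_\Delta\cap\mathbb{F}_q^{n_J}$. For $a\in\mathcal{H}_J$, $\mathfrak{I}_a=\{q^ia:i\ge0\}\subseteq\mathbb{Z}/(N_1-1)\mathbb{Z}$ is the minimal cyclotomic set containing $a$, indexed by its smallest element. **Localities.** For a linear code $\mathcal{C}\subseteq\mathbb{F}_q^n$, $d(\cdot)$ denotes minimum distance; for $\overline{R}\subseteq\{1,\dots,n\}$, $\mathcal{C}[\overline{R}]$ is the projection of $\mathcal{C}$ onto the coordinates in $\overline{R}$. A set $R\not\ni i$ is a recovery set for coordinate $i$ if the $i$-th column of a generator matrix of $\mathcal{C}$ is in the span of the columns indexed by $R$. The locality of $i$ is the smallest size of a recovery set for $i$; $\mathcal{C}$ is LRC if every coordinate has a recovery set, and its (classical) locality is the maximum of the localities of its coordinates. An LRC code $\mathcal{C}$ is sharp if its classical locality equals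 $d(\mathcal{C}^\perp)-1$. $\mathcal{C}$ has locality $(r,\delta)$ if for every coordinate $i$ there is $\overline{R}\subseteq\{1,\dots,n\}$ with $i\in\overline{R}$, $\#\overline{R}\le r+\delta-1$ and $d(\mathcal{C}[\overline{R}])\ge\delta$. For $t=1,\dots,d(\mathcal{C})-1$ the $t$-locality is $$r_t=\min\{\rho:\ \text{for all } i \text{ there is } \overline{R}_i \text{ with } i\in\overline{R}_i,\ \#\overline{R}_i\le\rho,\ d(\mathcal{C}[\overline{R}_i])\ge t+1\}-1,$$ and for an $[n,k,d]$ code the $t$-th LRC-Singleton defect is $$D_t=n+t+1-d-k-\left\lceil\frac{k}{r_t-t+1}\right\rceil t .$$
   Formalization: The bound on the Singleton defect is stated only for r ≥ 2; for r = 1 the code is the repetition code, whose defect is 0, while the right-hand side equals −1. All other conclusions are stated for every 1 ≤ r ≤ q−2. *)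

(* Defs.v *)
From HB Require Import structures.
From mathcomp Require Import all_boot all_order all_algebra.

Set Implicit Arguments.
Unset Strict Implicit.
Unset Printing Implicit Defensive.

Import Order.TTheory GRing.Theory Num.Theory.
Local Open Scope ring_scope.

(* Linear codes of length n over a finite field F are the subspaces of
   'rV[F]_n; coordinates are indexed by 'I_n, i.e. from 0. *)

Definition hamming (F : finFieldType) n (u v : 'rV[F]_n) : nat :=
  #|[set i | u 0 i != v 0 i]|.

(* Every Hamming distance is at most n, so the default value n.+1 is only
   reached by the zero code. *)
Definition min_distance (F : finFieldType) n (C : {vspace 'rV[F]_n}) : nat :=
  \big[minn/n.+1]_(p : 'rV[F]_n * 'rV[F]_n
                   | [&& p.1 \in C, p.2 \in C & p.1 != p.2]) hamming p.1 p.2.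

(* The filtered set is already a subspace, see mem_dual_code. *)
Definition dual_code (F : finFieldType) n (C : {vspace 'rV[F]_n}) :
    {vspace 'rV[F]_n} :=
  span [seq v : 'rV[F]_n <- enum {: 'rV[F]_n} |
        [forall c : 'rV[F]_n, (c \in C) ==> (\sum_i v 0 i * c 0 i == 0)]].

(* The projection C[R], as a code of length #|R|. *)
Definition projected_code (F : finFieldType) n (C : {vspace 'rV[F]_n})
    (R : {set 'I_n}) : {vspace 'rV[F]_#|R|} :=
  (linfun (fun c : 'rV[F]_n => colsub (@enum_val _ (mem R)) c) @: C)%VS.

Definition generator_matrix (F : finFieldType) n (C : {vspace 'rV[F]_n}) :
    'M[F]_(\dim C, n) :=
  \matrix_(j < \dim C) (vbasis C)`_j.

Definition recovery_set (F : finFieldType) n (C : {vspace 'rV[F]_n})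
    (i : 'I_n) (R : {set 'I_n}) : bool :=
  let G := generator_matrix C in
  (i \notin R) && (col i G \in span [seq col j G | j in R]).

(* Recovery sets have fewer than n elements, so the default value n is only
   reached when coordinate i has no recovery set. *)
Definition coord_locality (F : finFieldType) n (C : {vspace 'rV[F]_n})
    (i : 'I_n) : nat :=
  \big[minn/n]_(R : {set 'I_n} | recovery_set C i R) #|R|.

Definition LRC (F : finFieldType) n (C : {vspace 'rV[F]_n}) : Prop :=
  forall i : 'I_n, exists R : {set 'I_n}, recovery_set C i R.

Definition classical_locality (F : finFieldType) n (C : {vspace 'rV[F]_n}) :
    nat :=
  (\max_(i < n) coord_locality C i)%N.

Definition sharp_LRC (F : finFieldType) n (C : {vspace 'rV[F]_n}) : Prop :=
  LRC C /\ classical_locality C = (min_distance (dual_code C) - 1)%N.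

Definition has_locality (F : finFieldType) n (C : {vspace 'rV[F]_n})
    (r delta : nat) : Prop :=
  forall i : 'I_n, exists R : {set 'I_n},
    [/\ i \in R, (#|R| <= r + delta - 1)%N
      & (delta <= min_distance (projected_code C R))%N].

Definition t_recoverable (F : finFieldType) n (C : {vspace 'rV[F]_n})
    (t rho : nat) : bool :=
  [forall i : 'I_n, exists R : {set 'I_n},
    [&& i \in R, (#|R| <= rho)%N
      & (t.+1 <= min_distance (projected_code C R))%N]].

(* r_t, meant for 0 < t < min_distance C: then rho = n is admissible (take
   R = setT), so the minimum may be taken over rho <= n and the default value
   is harmless. *)
Definition t_locality (F : finFieldType) n (C : {vspace 'rV[F]_n}) (t : nat) :
    int :=
  (\big[minn/n]_(rho < n.+1 | t_recoverable C t rho) (rho : nat))%:Z - 1.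

Definition singleton_defect (F : finFieldType) n (C : {vspace 'rV[F]_n})
    (t : nat) : int :=
  n%:Z + t%:Z + 1 - (min_distance C)%:Z - (\dim C)%:Z
  - Num.ceil ((\dim C)%:Q / (t_locality C t - t%:Z + 1)%:Q) * t%:Z.

(* Z/NZ is represented by 'I_N, and the cyclotomic set of a is the orbit of a
   under multiplication by q, see mem_cyclotomic_set. The default value of
   insubd is never used, since N > 0 as soon as 'I_N is inhabited. *)
Definition cyclotomic_set (N q : nat) (a : 'I_N) : {set 'I_N} :=
  [set b | fconnect (fun x : 'I_N => insubd x (q * x %% N)%N) a b].

Definition eval_code (K : finFieldType) n (P : n.-tuple K) N
    (Delta : {set 'I_N}) : {vspace 'rV[K]_n} :=
  span [seq \row_(i < n) tnth P i ^+ a | a : 'I_N in Delta].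

(* The filtered set is already a subspace, see mem_subfield_subcode. *)
Definition subfield_subcode (F K : finFieldType) (iota : {rmorphism F -> K}) n
    (E : {vspace 'rV[K]_n}) : {vspace 'rV[F]_n} :=
  span [seq c : 'rV[F]_n <- enum {: 'rV[F]_n} | map_mx iota c \in E].

Lemma mem_span_closed (F : finFieldType) n (p : pred 'rV[F]_n) :
  p 0 -> (forall (k : F) u v, p u -> p v -> p (k *: u + v)) ->
  forall v, (v \in span [seq c : 'rV[F]_n <- enum {: 'rV[F]_n} | p c]) = p v.
Proof.
move=> p0 pD v; apply/idP/idP => [|pv]; last first.
  by apply: memv_span; rewrite mem_filter pv mem_enum.
set s := [seq _ <- _ | _]; have ps i : (i < size s)%N -> p s`_i.
  by move=> lt_i; have := mem_nth 0 lt_i; rewrite mem_filter => /andP[].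
rewrite (span_def s) big_tnth => /memv_sumP[w ws ->].
elim/big_ind: _ => // [x y px py|i _]; first by rewrite -[x]scale1r; apply: pD.
have /vlineP[k ->] := ws i isT.
by rewrite -[_ *: _]addr0; apply: pD => //; rewrite (tnth_nth 0) ps.
Qed.

Lemma mem_dual_code (F : finFieldType) n (C : {vspace 'rV[F]_n})
    (v : 'rV[F]_n) :
  reflect (forall c, c \in C -> \sum_i v 0 i * c 0 i = 0) (v \in dual_code C).
Proof.
rewrite mem_span_closed => [||k u w /forallP pu /forallP pw].
- by apply: (iffP 'forall_implyP) => h c /h /eqP.
- by apply/'forall_implyP => c _; apply/eqP/big1 => i _; rewrite mxE mul0r.
apply/'forall_implyP => c cC.
move: (pu c) (pw c); rewrite cC /= => /eqP hu /eqP hw.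
under eq_bigr => i _ do rewrite !mxE mulrDl -mulrA.
by rewrite big_split /= -mulr_sumr hu hw mulr0 addr0.
Qed.

Lemma mem_subfield_subcode (F K : finFieldType) (iota : {rmorphism F -> K}) n
    (E : {vspace 'rV[K]_n}) (c : 'rV[F]_n) :
  (c \in subfield_subcode iota E) = (map_mx iota c \in E).
Proof.
rewrite (mem_span_closed (p := fun c => map_mx iota c \in E)) //.
  by rewrite map_mx0 mem0v.
by move=> k u v uE vE; rewrite map_mxD map_mxZ memvD ?memvZ.
Qed.

Lemma mem_cyclotomic_set N q (a b : 'I_N) :
  b \in cyclotomic_set q a <-> exists i, b = q ^ i * a %[mod N].
Proof.
pose f (x : 'I_N) : 'I_N := insubd x (q * x %% N)%N.
have fE i : iter i f a = (q ^ i * a %% N)%N :> nat.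
  elim: i => [|i IHi]; first by rewrite expn0 mul1n modn_small.
  have N_gt0 : (0 < N)%N by apply: leq_ltn_trans (ltn_ord a).
  by rewrite iterS val_insubd ltn_pmod // IHi modnMmr mulnA -expnS.
rewrite inE; split=> [/iter_findex <-|[i ab]].
  by eexists; rewrite fE modn_mod.
suff ->: b = iter i f a by apply: fconnect_iter.
by apply: val_inj; rewrite /= fE -ab modn_small.
Qed.

Lemma mem_projected_code (F : finFieldType) n (C : {vspace 'rV[F]_n})
    (R : {set 'I_n}) (w : 'rV[F]_#|R|) :
  w \in projected_code C R <->
  exists2 c, c \in C & forall j, w 0 j = c 0 (enum_val j).
Proof.
split=> [/memv_imgP[c cC ->]|[c cC wE]].
  by exists c => // j; rewrite lfunE /= mxE.
suff ->: w = linfun (colsub (@enum_val _ (mem R))) c by apply: memv_img.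
by apply/rowP => j; rewrite lfunE /= mxE wE.
Qed.

(* Main.v *)
Require Import Defs.
From HB Require Import structures.
From mathcomp Require Import all_boot all_order all_fingroup all_algebra.
From mathcomp Require Import all_solvable all_field zify ring lra.

(* On the 2(q-1) evaluation points, [x^(q-1)] is a sign: each sign is taken by
   q-1 points. Since [x^(a+q-1) = x^(q-1) x^a], a word of the code restricts, on
   the points of sign s, to the evaluation of [u + s v], where [u] and [v] have
   degree less than [r] and [v] is odd. So each sign class carries a punctured
   Reed-Solomon code of length q-1 and distance q-r, which gives the localities.
   For the minimum distance, either both restrictions are nonzero, or one of
   them vanishes and the other comes from an odd polynomial, which has at most
   [2 floor((r-2)/2)] nonzero roots.
   As [Delta] is stable under multiplication by q, the evaluation code over F_Q
   is stable under Frobenius, hence equal to [C + w C] for any w outside F_q: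
   this yields the dimension of [C], and, evaluating [prod_(j in R) (X - P_j)]
   for [#|R| < r], shows that [R] is never a recovery set. *)

Set Implicit Arguments.
Unset Strict Implicit.
Unset Printing Implicit Defensive.

Import Order.TTheory GRing.Theory Num.Theory.
Local Open Scope ring_scope.

(** * Bounds on minima, and coefficients of a vector in a span *)

Lemma leq_bigmin (I : finType) (P : pred I) (F : I -> nat) x0 m :
  (m <= x0)%N -> (forall i, P i -> (m <= F i)%N) ->
  (m <= \big[minn/x0]_(i | P i) F i)%N.
Proof. by move=> m0 mF; elim/big_ind: _ => // x y mx my; rewrite leq_min mx. Qed.

Lemma bigmin_leq (I : finType) (P : pred I) (F : I -> nat) x0 i :
  P i -> (\big[minn/x0]_(j | P j) F j <= F i)%N.
Proof.
rewrite unlock => Pi; have : i \in index_enum I by rewrite mem_index_enum.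
elim: (index_enum I) => // j s IHs; rewrite inE /= => /predU1P[<-|/IHs le_s].
  by rewrite Pi geq_minl.
by case: ifP => // _; apply: leq_trans le_s; rewrite geq_minr.
Qed.

Lemma min_distance_leq_hamming (F : finFieldType) n (C : {vspace 'rV[F]_n}) u v :
  u \in C -> v \in C -> u != v -> (min_distance C <= hamming u v)%N.
Proof.
move=> uC vC uv.
apply: (@bigmin_leq _ _ (fun p => hamming p.1 p.2) _ (u, v)).
by rewrite /= uC vC.
Qed.

Lemma mem_span_image (K : fieldType) (vT : vectType K) (I : finType) (A : {set I})
    (f : I -> vT) x :
  x \in span [seq f i | i in A] ->
  exists l : I -> K, x = \sum_(i in A) l i *: f i.
Proof.
rewrite span_def big_image /= => /memv_sumP[v vs ->].
have /fin_all_exists[l lE] i : exists k, i \in A -> v i = k *: f i.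
  have [iA|_] := boolP (i \in A); last by exists 0.
  by have /vlineP[k ->] := vs i iA; exists k.
by exists l; apply: eq_bigr.
Qed.

(** * Weights, projections and recovery sets of linear codes *)

Section Codes.
Variables (F : finFieldType) (n : nat).
Implicit Types (C : {vspace 'rV[F]_n}) (R : {set 'I_n}) (c : 'rV[F]_n).

Definition weight c : nat := #|[set i | c 0 i != 0]|.

(** Differences of codewords are codewords. The bound [d <= n.+1] covers the zero code, where
    [min_distance] takes its default value. *)
Lemma leq_min_distance C d :
  (d <= n.+1)%N -> (forall c, c \in C -> c != 0 -> (d <= weight c)%N) ->
  (d <= min_distance C)%N.
Proof.
move=> d_le dC; apply: leq_bigmin => // -[u v] /= /and3P[uC vC uv].
have := dC (u - v); rewrite memvB // subr_eq0 uv => /(_ isT isT).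
congr (_ <= _)%N; apply: eq_card => i.
by rewrite !inE !mxE subr_eq0.
Qed.

Lemma min_distance_leq C c :
  c \in C -> c != 0 -> (min_distance C <= weight c)%N.
Proof.
move=> cC c0; apply: leq_trans (min_distance_leq_hamming cC (mem0v C) c0) _.
by apply/eq_leq/eq_card => i; rewrite !inE !mxE.
Qed.

(** Lifts projected words to codewords of [C], so that weights are counted on [R] itself and not on
    the ordinals that enumerate it. *)
Lemma leq_min_distance_proj C R d :
  (d <= #|R|.+1)%N ->
  (forall c, c \in C -> (exists2 i, i \in R & c 0 i != 0) ->
     (d <= #|[set i in R | c 0%R i != 0%R]|)%N) ->
  (d <= min_distance (projected_code C R))%N.
Proof.
move=> d_le dC; apply: leq_bigmin => // -[u v] /= /and3P[uC vC uv].
have [c cC cE] : exists2 c, c \in C & forall j, (u - v) 0 j = c 0 (enum_val j).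
  by apply/mem_projected_code; rewrite memvB.
have hE j : (c 0 (enum_val j) != 0) = (u 0 j != v 0 j).
  by rewrite -cE !mxE subr_eq0.
have cR : exists2 i, i \in R & c 0 i != 0.
  have : [exists j, u 0 j != v 0 j].
    apply: contraNT uv => /existsPn uv; apply/eqP/rowP => j; apply/eqP.
    by rewrite -[_ == _]negbK uv.
  by case/existsP=> j uvj; exists (enum_val j); [apply: enum_valP | rewrite hE].
apply: leq_trans (dC c cC cR) _; rewrite /hamming -(card_imset _ enum_val_inj).
apply/subset_leq_card/subsetP => i; rewrite inE => /andP[iR ci].
apply/imsetP; exists (enum_rank_in iR i); last by rewrite enum_rankK_in.
by rewrite inE -hE enum_rankK_in.
Qed.

Lemma min_distance_proj_leq C R c i :
  c \in C -> i \in R -> c 0 i != 0 ->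
  (min_distance (projected_code C R) <= #|R|)%N.
Proof.
move=> cC iR ci; pose w : 'rV_#|R| := \row_j c 0 (enum_val j).
have wC : w \in projected_code C R.
  by apply/mem_projected_code; exists c => // j; rewrite mxE.
have w0 : w != 0.
  apply: contra ci => /eqP/rowP/(_ (enum_rank_in iR i)).
  by rewrite !mxE enum_rankK_in // => ->.
apply: leq_trans (min_distance_leq_hamming wC (mem0v _) w0) _.
by rewrite -[X in (_ <= X)%N]card_ord; apply: max_card.
Qed.

Lemma generator_matrix_combine C (x : 'rV[F]_(\dim C)) :
  x *m generator_matrix C \in C.
Proof.
rewrite mulmx_sum_row memv_suml // => j _; rewrite memvZ // rowK.
by apply: vbasis_mem; rewrite mem_nth // size_tuple.
Qed.

Lemma code_generator_matrix C c :
  c \in C -> exists x, c = x *m generator_matrix C.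
Proof.
move=> /coord_vbasis ->; eexists (\row_j coord (vbasis C) j c).
rewrite mulmx_sum_row; apply: eq_bigr => j _.
by rewrite mxE rowK.
Qed.

Lemma recovery_set_combine C i R :
  recovery_set C i R ->
  exists l : 'I_n -> F, forall c, c \in C -> c 0 i = \sum_(j in R) l j * c 0 j.
Proof.
case/andP=> _; set G := generator_matrix C.
move=> /mem_span_image[l iE]; exists l => c /code_generator_matrix[x ->].
rewrite -/G !mxE -[LHS]/(\sum_j _ * _).
transitivity (\sum_j x 0 j * (col i G) j 0); first by apply: eq_bigr => j _; rewrite !mxE.
rewrite iE; under eq_bigr => j _ do rewrite summxE mulr_sumr.
rewrite exchange_big; apply: eq_bigr => k _; rewrite mxE mulr_sumr.
by apply: eq_bigr => j _; rewrite !mxE mulrCA.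
Qed.

(** Duality: column [i] lies outside the span of the columns in [R] exactly when some combination of
    the rows, that is a codeword, vanishes on [R] but not at [i]. *)
Lemma recovery_setP C i R :
  reflect (i \notin R /\
     forall c, c \in C -> (forall j, j \in R -> c 0 j = 0) -> c 0 i = 0)
  (recovery_set C i R).
Proof.
apply: (iffP idP) => [rec_iR|[iR vanish]].
  split=> [|c cC c0]; first by case/andP: rec_iR.
  have [l ->//] := recovery_set_combine rec_iR.
  by rewrite big1 // => j /c0 ->; rewrite mulr0.
rewrite /recovery_set iR /=; set G := generator_matrix C.
(* Zero rows outside [R] keep the indexing by all coordinates; the row space is still the span of
   the columns in [R]. *)
pose M : 'M_(n, \dim C) := \matrix_j (if j \in R then (col j G)^T else 0).
have [/submxP[D iE]|] := boolP ((col i G)^T <= M)%MS.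
  have -> : col i G = \sum_j D 0 j *: (row j M)^T.
    rewrite -[LHS]trmxK iE mulmx_sum_row linear_sum /=.
    by apply: eq_bigr => j _; rewrite linearZ.
  apply: memv_suml => j _; rewrite rowK; apply: memvZ.
  case: ifP => [jR|_]; last by rewrite trmx0 mem0v.
  by rewrite trmxK; apply/memv_span/image_f.
(* Column [y] of the cokernel is orthogonal to all columns in [R] but not to column [i]: it holds
   the coefficients of the separating codeword. *)
rewrite submxE; case/rV0Pn=> y; set x := cokermx M; case/negP.
pose c := (col y x)^T *m G.
have cE j : c 0 j = ((col j G)^T *m x) 0 y.
  by rewrite !mxE; apply: eq_bigr => k _; rewrite !mxE mulrC.
rewrite -cE; apply/eqP/vanish; first exact: generator_matrix_combine.
move=> j jR; rewrite cE.
have -> : (col j G)^T = row j M by rewrite rowK jR.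
by rewrite -row_mul mulmx_coker !mxE.
Qed.

Lemma classical_localityE C r :
  (0 < n)%N -> (r < n)%N ->
  (forall i, exists2 R, recovery_set C i R & (#|R| <= r)%N) ->
  (forall i R, recovery_set C i R -> (r <= #|R|)%N) ->
  classical_locality C = r.
Proof.
move=> n_gt0 r_lt recC minC.
have locE i : coord_locality C i = r.
  apply/eqP; rewrite eqn_leq; apply/andP; split.
    have [R recR le_R] := recC i.
    by apply: leq_trans le_R; apply: (bigmin_leq (fun R : {set 'I_n} => #|R|)).
  by apply: leq_bigmin (ltnW r_lt) _ => R; apply: minC.
apply/eqP; rewrite eqn_leq; apply/andP; split.
  by apply/bigmax_leqP => i _; rewrite locE.
by rewrite -(locE (Ordinal n_gt0)); apply: leq_bigmax.
Qed.

(** A recovery relation at [i], with coefficient -1 at [i], is a dual word supported in [i |: R].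
    Conversely, the support of a dual word, minus one of its points, is a recovery set for that
    point. *)
Lemma min_distance_dual C r :
  (0 < n)%N -> (r < n)%N ->
  (forall i, exists2 R, recovery_set C i R & (#|R| <= r)%N) ->
  (forall i R, recovery_set C i R -> (r <= #|R|)%N) ->
  min_distance (dual_code C) = r.+1.
Proof.
move=> n_gt0 r_lt recC minC.
apply/eqP; rewrite eqn_leq; apply/andP; split.
  have [R recR le_R] := recC (Ordinal n_gt0).
  set i := Ordinal n_gt0 in recR.
  have [l lE] := recovery_set_combine recR.
  have iR : i \notin R by case/andP: recR.
  pose v : 'rV[F]_n := \row_j (if j == i then - 1 else if j \in R then l j else 0).
  have vC : v \in dual_code C.
    apply/mem_dual_code => c cC.
    rewrite (bigD1 i) //= mxE eqxx mulN1r (lE c cC) addrC; apply/eqP.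
    rewrite subr_eq0; apply/eqP.
    rewrite [RHS]big_mkcond [LHS]big_mkcond /=; apply: eq_bigr => j _.
    rewrite mxE; case: eqVneq => [->|_] /=; first by rewrite (negPf iR).
    by case: ifP => //; rewrite mul0r.
  have v0 : v != 0.
    by apply/eqP => /rowP/(_ i)/eqP; rewrite !mxE eqxx oppr_eq0 oner_eq0.
  apply: leq_trans (min_distance_leq vC v0) _.
  apply: (@leq_trans #|i |: R|); last by rewrite cardsU1 iR.
  apply/subset_leq_card/subsetP => j; rewrite !inE mxE.
  by case: (j == i) => //=; case: (j \in R); rewrite ?eqxx.
apply: leq_min_distance => [|v /mem_dual_code vC /rV0Pn[i vi]].
  by rewrite ltnS ltnW.
rewrite /weight (cardsD1 i) inE vi add1n ltnS; apply: (minC i).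
apply/recovery_setP; split=> [|c cC c0]; first by rewrite !inE eqxx.
have := vC c cC; rewrite (bigD1 i) //= big1 ?addr0 => [/eqP|j ji].
  by rewrite mulf_eq0 (negPf vi) => /eqP.
have [->|vj] := eqVneq (v 0 j) 0; first by rewrite mul0r.
by rewrite c0 ?mulr0 // !inE ji.
Qed.

End Codes.

(** * Subfield subcodes of Frobenius-stable codes over a quadratic extension *)

Section Descent.
Variables (F K : finFieldType) (iota : {rmorphism F -> K}).

Lemma exprD_card_subfield (x y : K) :
  (x + y) ^+ #|F| = x ^+ #|F| + y ^+ #|F|.
Proof.
have [p p_pr pF] := finPcharP F; apply: exprDn_pchar.
have /abelem_pgroup := fin_ring_pchar_abelem pF.
rewrite /pgroup cardsT; apply: sub_in_pnat => l _ /eqP->.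
by rewrite (fmorph_pchar iota).
Qed.

(** [X^#|F| - X] already splits over [F], so its roots in [K] all come from [F]. *)
Lemma subfieldP (x : K) : x ^+ #|F| = x -> exists a, x = iota a.
Proof.
move=> /eqP; rewrite -subr_eq0.
have := congr1 (map_poly iota) (finField_genPoly F).
rewrite rmorphB rmorph_prod rmorphXn /= map_polyX => /(congr1 (horner^~ x)).
rewrite hornerD hornerN hornerXn hornerX => ->.
rewrite horner_prod prodf_seq_eq0 => /hasP[a _ /=].
by rewrite rmorphB /= map_polyX map_polyC /= hornerXsubC subr_eq0 => /eqP; exists a.
Qed.

Lemma subfield_exp (a : F) : iota a ^+ #|F| = iota a.
Proof. by rewrite -rmorphXn /= expf_card. Qed.

Hypothesis card_K : #|K| = (#|F| ^ 2)%N.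

(** Any [w] outside the image of [F] is independent of 1 over [F]; the map from [F * F] to [K] is
    then injective between sets of equal size, hence onto. *)
Lemma quadratic_decomposition :
  exists2 w : K, w ^+ #|F| != w &
    (forall x, exists a b, x = iota a + w * iota b) /\
    (forall a b a' b', iota a + w * iota b = iota a' + w * iota b' ->
        a = a' /\ b = b').
Proof.
have F_gt1 : (1 < #|F|)%N by apply: finNzRing_gt1.
have [w wF] : exists w : K, w \notin codom iota.
  apply/existsP; rewrite -negb_forall; apply: contraTN F_gt1 => /forallP wF.
  suff : (#|K| <= #|F|)%N by rewrite card_K; nia.
  rewrite -(card_codom (fmorph_inj iota)); apply/subset_leq_card/subsetP.
  by move=> w _; apply: wF.
have w_inj a b a' b' : iota a + w * iota b = iota a' + w * iota b' -> a = a' /\ b = b'.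
  move=> e; have e' : w * iota (b - b') = iota (a' - a).
    rewrite !rmorphB mulrBr; apply/eqP; rewrite subr_eq addrAC -e.
    by rewrite [X in X - _]addrC addrK.
  have [/eqP|bb] := eqVneq (b - b') 0.
    rewrite subr_eq0 => /eqP bb; split=> //; move: e; rewrite bb => /addIr.
    exact: fmorph_inj.
  case/negP: wF; apply/codomP; exists ((a' - a) / (b - b')).
  by rewrite fmorph_div -e' mulfK // fmorph_eq0.
exists w; first by apply: contra wF => /eqP/subfieldP[a ->]; apply: codom_f.
split=> // x; pose f (ab : F * F) := iota ab.1 + w * iota ab.2.
have f_inj : injective f by move=> [a b] [a' b'] /w_inj[/= -> ->].
have : x \in codom f.
  by rewrite inj_card_onto // card_prod card_K expnS expn1.
by case/codomP => -[a b] ->; exists a, b.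
Qed.

Variables (n : nat) (E : {vspace 'rV[K]_n}).
Hypothesis frob_E :
  forall e, e \in E -> map_mx (fun x => x ^+ #|F|) e \in E.

Lemma frobenius_closed_decomposition :
  exists w : K,
    (forall a b a' b', iota a + w * iota b = iota a' + w * iota b' ->
        a = a' /\ b = b') /\
    forall e, e \in E -> exists c c',
      [/\ c \in subfield_subcode iota E, c' \in subfield_subcode iota E
        & e = map_mx iota c + w *: map_mx iota c'].
Proof.
have [w wF [w_surj w_inj]] := quadratic_decomposition.
exists w; split=> // e eE.
have /fin_all_exists[a aP] i : exists a, exists b, e 0 i = iota a + w * iota b.
  exact: w_surj.
have [b eE'] := fin_all_exists aP.
pose c := \row_i a i; pose c' := \row_i b i.
have ecc : e = map_mx iota c + w *: map_mx iota c'.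
  by apply/rowP => i; rewrite !mxE eE'.
have c'E : map_mx iota c' \in E.
  (* Frobenius fixes the entries of [c] and [c'], so subtracting [e] from its Frobenius image leaves
     a nonzero multiple of [c']. *)
  suff : (w ^+ #|F| - w) *: map_mx iota c' \in E.
    by rewrite rpredZeq subr_eq0 (negPf wF).
  have -> : (w ^+ #|F| - w) *: map_mx iota c' = map_mx (fun x => x ^+ #|F|) e - e.
    apply/rowP => i; rewrite !mxE eE' exprD_card_subfield exprMn !subfield_exp.
    by rewrite opprD addrACA subrr add0r mulrBl.
  by rewrite memvB ?frob_E.
exists c, c'; rewrite !mem_subfield_subcode c'E; split=> //.
have -> : map_mx iota c = e - w *: map_mx iota c' by rewrite ecc addrK.
by rewrite memvB // memvZ.
Qed.

(** The map sending [(c, c')] to [c + w c'] is a bijection from pairs of words of the subcode onto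
    [E]; compare cardinals. *)
Lemma dim_subfield_subcode : \dim (subfield_subcode iota E) = \dim E.
Proof.
have [w [w_inj w_surj]] := frobenius_closed_decomposition.
set C := subfield_subcode iota E in w_surj *.
pose f (x : 'rV[F]_n * 'rV[F]_n) := map_mx iota x.1 + w *: map_mx iota x.2.
have f_inj : injective f.
  move=> [a b] [a' b'] /rowP abE.
  suff abi i : a 0 i = a' 0 i /\ b 0 i = b' 0 i.
    by congr (_, _); apply/rowP => i; case: (abi i).
  by apply: w_inj; have := abE i; rewrite !mxE.
have : #|E| = #|setX [set x in C] [set x in C]|.
  rewrite -(card_imset _ f_inj); apply: eq_card => e; apply/idP/imsetP.
    by move=> /w_surj[c [c' [cC c'C ->]]]; exists (c, c'); rewrite // !inE cC.
  case=> -[c c'] /=; rewrite !inE /= !mem_subfield_subcode => /andP[cE c'E] ->.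
  by rewrite memvD // memvZ.
rewrite cardsX !cardsE !card_vspace card_K -expnD -expnM => /eqP.
by rewrite eqn_exp2l ?finNzRing_gt1 // addnn mul2n => /eqP/double_inj ->.
Qed.

End Descent.

(** * Evaluation codes and roots of polynomials *)

Lemma dim_eval_code (K : finFieldType) n (P : n.-tuple K) N (Delta : {set 'I_N}) :
  uniq P -> (N <= n)%N -> \dim (eval_code P Delta) = #|Delta|.
Proof.
move=> P_uniq le_Nn; pose f (a : 'I_N) := \row_(i < n) tnth P i ^+ a.
rewrite -[RHS](size_image f); apply/eqP.
apply/(freeP (X := image_tuple f Delta)) => k k0 i.
have fE (j : 'I_#|Delta|) : (image_tuple f Delta)`_j = f (enum_val j).
  by rewrite nth_image.
(* A linear relation between the generators is a polynomial of degree less than [n] vanishing at [n]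
   distinct points. *)
pose p := \sum_j k j *: 'X^(enum_val j).
have p_size : (size p <= n)%N.
  apply: leq_trans (size_sum _ _ _) _; apply/bigmax_leqP => j _.
  apply: leq_trans (size_scale_leq _ _) _.
  by rewrite size_polyXn (leq_trans _ le_Nn).
have p0 : p = 0.
  apply: (@roots_geq_poly_eq0 _ p P); rewrite ?size_tuple //.
  apply/allP => _ /tnthP[j ->]; apply/eqP.
  have /rowP/(_ j) := k0; rewrite summxE mxE => k0j.
  rewrite -[RHS]k0j horner_sum; apply: eq_bigr => l _.
  by rewrite fE !mxE hornerZ hornerXn.
have := coef0 K (enum_val i); rewrite -p0 coef_sum (bigD1 i) //=.
rewrite coefZ coefXn eqxx mulr1 big1 ?addr0 // => j ji.
rewrite coefZ coefXn; case: eqP => [/val_inj/enum_val_inj ij|]; last by rewrite mulr0.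
by rewrite ij eqxx in ji.
Qed.

(** The bound on the number of roots, in additive form to avoid truncated subtraction. *)
Lemma card_nonroots (K : fieldType) n (P : n.-tuple K) (A : {set 'I_n}) (f : {poly K}) :
  uniq P -> f != 0 ->
  (#|A| < #|[set i in A | ~~ root f (tnth P i)]| + size f)%N.
Proof.
move=> P_uniq f0; rewrite -(cardsID [set i | root f (tnth P i)] A) addnC.
have -> : A :\: [set i | root f (tnth P i)] = [set i in A | ~~ root f (tnth P i)].
  by apply/setP => i; rewrite !inE andbC.
rewrite ltn_add2l -(size_image (tnth P)); apply: max_poly_roots f0 _ _.
  by apply/allP => _ /imageP[i /setIP[_ +] ->]; rewrite inE.
by apply/dinjectiveP => i j _ _; apply: (tuple_uniqP _ P_uniq).
Qed.

(** [X^N - 1] divides [X^#|K| - X], a product of distinct linear factors, so it has exactly [N]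
    roots in [K]. *)
Lemma card_roots_unity (K : finFieldType) N n (P : n.-tuple K) :
  (0 < N)%N -> (N %| #|K|.-1)%N -> uniq P ->
  (forall x, (x \in P) = root ('X^N - 1) x) -> n = N.
Proof.
move=> N_gt0 /dvdnP[M MN] P_uniq P_roots.
have : ('X^N - 1) %| \prod_(x <- index_enum K) ('X - x%:P).
  rewrite -finField_genPoly -(ltn_predK (finNzRing_gt1 K)) MN mulnC exprS exprM.
  have -> : 'X * 'X^N ^+ M - 'X = 'X * ('X^N ^+ M - 1) :> {poly K}.
    by rewrite mulrBr mulr1.
  by rewrite [X in _ %| _ * X]subrX1; apply/dvdp_mull/dvdp_mulr.
case/dvdp_prod_XsubC=> m; set s := mask _ _ => Xs.
have s_uniq : uniq s by rewrite mask_uniq // index_enum_uniq.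
have Ps : P =i s.
  by move=> x; rewrite P_roots (eqp_root Xs) root_prod_XsubC.
rewrite -(size_tuple P) (perm_size (uniq_perm P_uniq s_uniq Ps)).
have := eqp_size Xs.
by rewrite size_prod_XsubC -[1]/(1%:P) size_XnsubC // => -[].
Qed.

(** Frobenius turns the row of exponent [a] into that of exponent [q * a], which may be reduced
    modulo [N] at [N]-th roots of unity and so stays in the cyclotomic set. *)
Lemma frobenius_closed_eval_code (F K : finFieldType) (iota : {rmorphism F -> K})
    N n (P : n.-tuple K) (A : {pred 'I_N}) e :
  (forall i, tnth P i ^+ N = 1) ->
  let E := eval_code P (\bigcup_(a in A) cyclotomic_set #|F| a) in
  e \in E -> map_mx (fun x => x ^+ #|F|) e \in E.
Proof.
move=> PN E /mem_span_image[l ->]; set q := #|F|.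
have -> : map_mx (fun x => x ^+ q)
      (\sum_(a in \bigcup_(a in A) cyclotomic_set q a) l a *: (\row_i tnth P i ^+ a)) =
    \sum_(a in \bigcup_(a in A) cyclotomic_set q a)
      l a ^+ q *: (\row_i tnth P i ^+ (q * a)).
  apply/rowP => i; rewrite !mxE !summxE.
  have q0 : 0 ^+ q = 0 :> K by rewrite expr0n gtn_eqF // (ltn_trans _ (finNzRing_gt1 F)).
  rewrite (big_morph _ (exprD_card_subfield iota) q0).
  by apply: eq_bigr => a _; rewrite !mxE exprMn mulnC exprM.
apply: memv_suml => a /bigcupP[b bA /mem_cyclotomic_set[j ab]]; apply: memvZ.
have N_gt0 : (0 < N)%N by apply: leq_ltn_trans (ltn_ord a).
pose a' := Ordinal (ltn_pmod (q * a) N_gt0).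
have -> : \row_i tnth P i ^+ (q * a) = \row_i tnth P i ^+ a' :> 'rV[K]_n.
  by apply/rowP => i; rewrite !mxE -[LHS](expr_mod _ (PN i)).
apply/memv_span/image_f/bigcupP; exists b => //; apply/mem_cyclotomic_set.
by exists j.+1; rewrite modn_mod expnS -mulnA -modnMmr ab modnMmr.
Qed.

(** * The exponents in [Delta] *)

Lemma count_odd_iota m r : count odd (iota m r) = (r + odd m)./2.
Proof.
elim: r m => [|r IHr] m /=; first by case: (odd m).
by rewrite IHr /=; case: (odd m); rewrite ?addn0 ?addn1.
Qed.

Section Code.
Variables (N q r : nat).
Hypotheses (q_odd : odd q) (r_le : (r <= q - 2)%N).
Hypothesis N_def : N = (2 * (q - 1))%N.
Let Delta : {set 'I_N} := \bigcup_(a < N | (a < r)%N) cyclotomic_set q a.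

(** Writing [q^i = 1 + (q-1) s], the residue of [q^i a] modulo [2(q-1)] depends only on the parity
    of [s a]: an even [a] is fixed, and an odd [a] has orbit [a], [a + q - 1]. *)
Lemma mem_Delta (x : 'I_N) :
  (x \in Delta) = (x < r)%N || odd x && (q - 1 <= x < q - 1 + r)%N.
Proof.
apply/bigcupP/idP => [[a a_lt /mem_cyclotomic_set[i xE]]|].
  have [s sE] : exists s, (q ^ i = 1 + (q - 1) * s)%N.
    exists (\sum_(j < i) q ^ j)%N.
    by rewrite subn1 -predn_exp add1n prednK // expn_gt0 odd_gt0.
  have : (q ^ i * a = (s * a)./2 * N + (a + (q - 1) * odd (s * a)))%N.
    rewrite sE mulnDl mul1n -mulnA -{1}(odd_double_half (s * a)).
    rewrite -muln2; move: (nat_of_bool _) (_./2) => o h; move: (nat_of_ord a) => a'.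
    by rewrite N_def; move: (q - 1)%N => m; ring.
  move: xE => + qE; rewrite qE modnMDl modn_small // oddM => xE.
  have : (a + (q - 1) * (odd s && odd a) < N)%N by case: (_ && _); lia.
  move=> /modn_small H; rewrite H in xE.
  have qm : odd (q - 1) = false by lia.
  rewrite xE; case: (odd s); case oa: (odd a); rewrite /= ?muln0 ?addn0 ?muln1 ?a_lt //.
  by rewrite oddD oa qm /=; lia.
case/orP=> [x_lt|/andP[x_odd x_le]].
  by exists x => //; apply/mem_cyclotomic_set; exists 0%N; rewrite expn0 mul1n.
have a_lt : (x - (q - 1) < N)%N by apply: leq_ltn_trans (leq_subr _ _) _.
exists (Ordinal a_lt) => /=; first by lia.
apply/mem_cyclotomic_set; exists 1%N; rewrite expn1 /=.
have -> : (q * (x - (q - 1)) = (x - (q - 1))./2 * N + x)%N.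
  have := odd_double_half (x - (q - 1)).
  have -> : odd (x - (q - 1)) by lia.
  nia.
by rewrite modnMDl.
Qed.

Lemma card_Delta : #|Delta| = (r + r./2)%N.
Proof.
pose p x := (x < r)%N || odd x && (q - 1 <= x < q - 1 + r)%N.
have -> : #|Delta| = count p (iota 0 N).
  rewrite -val_enum_ord count_map cardE.
  rewrite [in LHS]/enum_mem size_filter -enumT.
  by apply: eq_count => x; rewrite /= mem_Delta.
(* Cut the range into four intervals, which contribute respectively everything, nothing, the odd
   numbers, and nothing. *)
have -> : N = (r + ((q - 1 - r) + (r + (q - 1 - r))))%N by lia.
rewrite !iotaD !count_cat add0n subnKC; last by lia.
have /eq_in_count-> : {in iota 0 r, p =1 predT}.
  by move=> x; rewrite mem_iota /p /=; lia.
have /eq_in_count-> : {in iota r (q - 1 - r), p =1 pred0}.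
  by move=> x; rewrite mem_iota /p /=; lia.
have /eq_in_count-> : {in iota (q - 1) r, p =1 odd}.
  by move=> x; rewrite mem_iota /p /=; lia.
have /eq_in_count-> : {in iota (q - 1 + r) (q - 1 - r), p =1 pred0}.
  by move=> x; rewrite mem_iota /p /=; lia.
rewrite count_predT !count_pred0 size_iota count_odd_iota.
have -> : odd (q - 1) = false by lia.
by rewrite !addn0.
Qed.

End Code.

(** One root of an odd polynomial is spent at 0, which is not an evaluation point. The size of [f]
    is even; writing it as [2 * (size f)./2] lets a bound on the size pass through halving. *)
Lemma card_nonroots_odd (K : fieldType) n (P : n.-tuple K) (A : {set 'I_n})
    (f : {poly K}) :
  uniq P -> (forall i, tnth P i != 0) -> f != 0 ->
  (forall a, ~~ odd a -> f`_a = 0) ->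
  (#|A| + 1 < #|[set i in A | ~~ root f (tnth P i)]| + 2 * (size f)./2)%N.
Proof.
move=> P_uniq P0 f0 f_odd.
have : root f 0 by rewrite rootE horner_coef0 f_odd.
case/factor_theorem=> g; rewrite subr0 => fg.
have g0 : g != 0 by apply: contra f0 => /eqP g0; rewrite fg g0 mul0r.
have f_size : (2 * (size f)./2 = (size g).+1)%N.
  have : odd (size f).-1.
    by apply: contraR f0 => /f_odd/eqP; rewrite -lead_coefE lead_coef_eq0.
  by rewrite fg size_mulX //=; move: (size g) => m; lia.
rewrite f_size addn1 addnS ltnS.
have := card_nonroots A P_uniq g0.
congr (_ < _ + _)%N; apply: eq_card => i.
by rewrite !in_set fg rootM rootX (negPf (P0 i)) orbF.
Qed.

(** * The code on its two sign classes *)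

Section TwoHalves.
Variables (F K : finFieldType) (iota : {rmorphism F -> K}).
Variables (q N n r : nat) (P : n.-tuple K).
Hypotheses (card_F : #|F| = q) (card_K : #|K| = (q ^ 2)%N) (q_odd : odd q).
Hypotheses (N_def : N = (2 * (q - 1))%N) (P_uniq : uniq P).
Hypothesis P_roots : forall x : K, (x \in P) = root ('X^N - 1) x.
Hypotheses (r_gt0 : (0 < r)%N) (r_le : (r <= q - 2)%N).
Let Delta : {set 'I_N} := \bigcup_(a < N | (a < r)%N) cyclotomic_set q a.
Let E := eval_code P Delta.
Let C := subfield_subcode iota E.

Lemma length_roots : n = N.
Proof.
apply: card_roots_unity P_uniq P_roots; first by lia.
(* As [q] is odd, [q^2 - 1] is [2(q-1)] times the integer [(q+1)/2]. *)
rewrite card_K N_def; apply/dvdnP; exists q.+1./2; have := odd_double_half q.+1.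
by rewrite /= q_odd /=; nia.
Qed.

Lemma point_expN i : tnth P i ^+ N = 1.
Proof.
have := mem_tnth i P; rewrite P_roots rootE !hornerE subr_eq0.
by move/eqP.
Qed.

Lemma point_sign i : (tnth P i ^+ (q - 1) == 1) || (tnth P i ^+ (q - 1) == - 1).
Proof. by rewrite -eqf_sqr expr1n -exprM mulnC -N_def point_expN. Qed.

Definition sign_class (e : K) : {set 'I_n} := [set i | tnth P i ^+ (q - 1) == e].

Lemma leq_card_sign_class e : (#|sign_class e| <= q - 1)%N.
Proof.
have q1 : (0 < q - 1)%N by lia.
have f0 : 'X^(q - 1) - e%:P != 0 by rewrite -size_poly_gt0 size_XnsubC.
have := card_nonroots (sign_class e) P_uniq f0.
rewrite (_ : [set _ in _ | _] = set0) ?cards0 ?size_XnsubC //.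
apply/setP => i; rewrite !inE rootE !hornerE subr_eq0.
exact: andbN.
Qed.

Lemma card_sign_class_add :
  (q - 1 + (q - 1) <= #|sign_class 1%R| + #|sign_class (- 1)%R|)%N.
Proof.
rewrite -cardsUI; apply: leq_trans (leq_addr _ _).
have -> : sign_class 1 :|: sign_class (- 1) = setT.
  by apply/setP => i; rewrite !inE point_sign.
by rewrite cardsT card_ord length_roots N_def mul2n addnn.
Qed.

(** The two classes cover [2(q-1)] points, and each has at most [q-1], being made of roots of
    [X^(q-1) - e]. *)
Lemma card_sign_class e : (e == 1) || (e == - 1) -> #|sign_class e| = (q - 1)%N.
Proof.
have h := card_sign_class_add; have h1 := leq_card_sign_class 1.
have hN := leq_card_sign_class (- 1).
by case/orP=> /eqP->; move: h h1 hN;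
  move: #|sign_class 1| #|sign_class (- 1)| => x y; lia.
Qed.

Lemma sign_classP i : exists2 e, (e == 1) || (e == - 1) & i \in sign_class e.
Proof. by exists (tnth P i ^+ (q - 1)); rewrite ?point_sign ?inE. Qed.

(** If the signs agreed, a class of at most [q-1] points would contain all [2(q-1)] of them. *)
Lemma one_neqN1 : 1 != - 1 :> K.
Proof.
apply/eqP => e; have := card_sign_class_add; rewrite -e.
have := leq_card_sign_class 1.
have : sign_class 1 = setT.
  by apply/setP => i; have := point_sign i; rewrite !inE -e orbb.
move=> ->; rewrite cardsT card_ord length_roots; lia.
Qed.

(* On the points with [x^(q-1) = 1] (resp. [-1]) a word of [E] is the evaluation
   of [u + v] (resp. [u - v]), a polynomial of degree less than [r]. *)
Lemma mem_evalP e :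
  e \in E <-> exists u v : {poly K},
    [/\ (size u <= r)%N, (size v <= r)%N, forall a, ~~ odd a -> v`_a = 0
      & forall i, e 0 i = u.[tnth P i] + tnth P i ^+ (q - 1) * v.[tnth P i]].
Proof.
split=> [/mem_span_image[l ->]|[u [v [u_size v_size v_odd eE]]]].
  elim/big_ind: _ => [|x y [u [v [u_size v_size v_odd xE]]]|a].
  - exists 0, 0; rewrite size_poly0; split=> // [a _|i]; first by rewrite coef0.
    by rewrite !mxE horner0 mulr0 addr0.
  - move=> [u' [v' [u'_size v'_size v'_odd yE]]].
    exists (u + u'), (v + v'); split=> [||a a_odd|i].
    + by apply: leq_trans (size_polyD _ _) _; rewrite geq_max u_size.
    + by apply: leq_trans (size_polyD _ _) _; rewrite geq_max v_size.
    + by rewrite coefD v_odd // v'_odd // addr0.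
    by rewrite mxE xE yE !hornerD mulrDr addrACA.
  rewrite (mem_Delta q_odd r_le N_def) => /orP[a_lt|/andP[a_odd a_le]].
    exists (l a *: 'X^a), 0; split=> [||b _|i]; rewrite ?size_poly0 ?coef0 //.
      by apply: leq_trans (size_scale_leq _ _) _; rewrite size_polyXn.
    by rewrite !mxE horner0 mulr0 addr0 hornerZ hornerXn.
  exists 0, (l a *: 'X^(a - (q - 1))); split=> [||b b_odd|i]; rewrite ?size_poly0 //.
  - by apply: leq_trans (size_scale_leq _ _) _; rewrite size_polyXn; lia.
  - by rewrite coefZ coefXn; case: eqP => [b_eq|_]; rewrite ?mulr0 //; lia.
  by rewrite !mxE horner0 add0r hornerZ hornerXn mulrCA -exprD subnKC //; lia.
pose w a : 'rV[K]_n := \row_i tnth P i ^+ a.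
have wE a : (a < r)%N || odd a && (q - 1 <= a < q - 1 + r)%N -> w a \in E.
  move=> a_in; have a_lt : (a < N)%N by lia.
  apply/memv_span/(image_f _ (x := Ordinal a_lt)).
  by rewrite (mem_Delta q_odd r_le N_def).
have -> : e = \sum_(a < r) u`_a *: w a + \sum_(a < r) v`_a *: w (q - 1 + a)%N.
  apply/rowP => i; rewrite eE mxE !summxE.
  rewrite (horner_coef_wide _ u_size) (horner_coef_wide _ v_size) mulr_sumr.
  congr (_ + _); apply: eq_bigr => a _; rewrite !mxE //.
  by rewrite exprD mulrCA.
apply: memvD; apply: memv_suml => a _; first by apply/memvZ/wE; rewrite ltn_ord.
have [a_odd|a_even] := boolP (odd a); last by rewrite v_odd // scale0r mem0v.
by apply/memvZ/wE; have := ltn_ord a; lia.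
Qed.

Lemma sign_class_polynomial e c : c \in C ->
  exists2 f : {poly K}, (size f <= r)%N &
    forall i, i \in sign_class e -> iota (c 0 i) = f.[tnth P i].
Proof.
rewrite mem_subfield_subcode => /mem_evalP[u [v [u_size v_size v_odd cE]]].
exists (u + e *: v) => [|i].
  apply: leq_trans (size_polyD _ _) _; rewrite geq_max u_size.
  exact: leq_trans (size_scale_leq _ _) v_size.
by rewrite inE => /eqP <-; have := cE i; rewrite mxE hornerD hornerZ.
Qed.

Lemma frobenius_E e : e \in E -> map_mx (fun x => x ^+ #|F|) e \in E.
Proof.
rewrite /E /Delta -card_F; apply: (frobenius_closed_eval_code iota).
exact: point_expN.
Qed.

Lemma dim_C : \dim C = (r + r./2)%N.
Proof.
have card_KF : #|K| = (#|F| ^ 2)%N by rewrite card_F.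
rewrite /C (dim_subfield_subcode iota card_KF frobenius_E).
by rewrite dim_eval_code ?length_roots // card_Delta.
Qed.

(** Additive form of the bound, with [floor((r-2)/2) = r./2 - 1]. *)
Lemma min_distance_C : (q + 1 <= min_distance C + 2 * r./2)%N.
Proof.
rewrite [leqRHS]addnC -leq_subLR; apply: leq_min_distance.
  by rewrite length_roots; lia.
move=> c cC c0; rewrite leq_subLR.
have := cC; rewrite mem_subfield_subcode => /mem_evalP[u [v [u_size v_size v_odd cE]]].
pose f e := u + e *: v.
have f_size e : (size (f e) <= r)%N.
  apply: leq_trans (size_polyD _ _) _; rewrite geq_max u_size.
  exact: leq_trans (size_scale_leq _ _) v_size.
have fE e i : i \in sign_class e -> iota (c 0 i) = (f e).[tnth P i].
  by rewrite inE => /eqP <-; have := cE i; rewrite mxE hornerD hornerZ.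
pose nz e := [set i in sign_class e | ~~ root (f e) (tnth P i)].
have nz_weight e : nz e \subset [set i | c 0 i != 0].
  apply/subsetP => i; rewrite !inE => /andP[ie].
  by rewrite rootE -fE ?inE // fmorph_eq0.
have nzD : (#|nz 1%R| + #|nz (- 1)%R| <= weight c)%N.
  rewrite -cardsUI (_ : nz 1 :&: nz (- 1) = set0) ?cards0 ?addn0.
    by rewrite subset_leq_card // subUset !nz_weight.
  apply/setP => i; rewrite !inE; apply/negP.
  by case/andP => /andP[/eqP-> _] /andP[/eqP/eqP]; rewrite (negPf one_neqN1).
have nz_size e : (e == 1) || (e == - 1) -> f e != 0 -> (q - 1 < #|nz e| + size (f e))%N.
  by move=> he /(card_nonroots (sign_class e) P_uniq); rewrite card_sign_class.
(* If [u - e v = 0], then [u + e v = 2 e v] is odd, like [v]. *)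
have nz_odd e : (e == 1) || (e == - 1) -> f (- e) = 0 -> f e != 0 ->
    (q + 1 <= #|nz e| + 2 * r./2)%N.
  move=> he /eqP fN fe.
  have fe_odd a : ~~ odd a -> (f e)`_a = 0.
    move: fN; rewrite /f scaleNr subr_eq0 => /eqP-> a_even.
    by rewrite coefD !coefZ v_odd // mulr0 addr0.
  have P0 i : tnth P i != 0.
    apply/eqP => Pi; have /eqP := point_expN i.
    have N_neq0 : N != 0%N by lia.
    by rewrite Pi expr0n (negPf N_neq0) eq_sym oner_eq0.
  have := card_nonroots_odd (sign_class e) P_uniq P0 fe fe_odd.
  rewrite card_sign_class //.
  by have := half_leq (f_size e); rewrite -/(nz e); lia.
have sgn1 : (1 == 1 :> K) || (1 == - 1 :> K) by rewrite eqxx.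
have sgnN : (- 1 == 1 :> K) || (- 1 == - 1 :> K) by rewrite eqxx orbT.
rewrite [leqRHS]addnC; apply: leq_trans _ (leq_add nzD (leqnn _)).
have [f1|f1] := eqVneq (f 1) 0.
  have fN : f (- 1) != 0.
    apply: contra c0 => /eqP fN; apply/eqP/rowP => i; rewrite mxE; apply/eqP.
    have [e he ie] := sign_classP i.
    rewrite -(fmorph_eq0 iota) (fE e) //.
    by case/orP: he => /eqP->; rewrite ?f1 ?fN horner0.
  apply: leq_trans (nz_odd _ sgnN _ fN) _; first by rewrite opprK.
  by rewrite leq_add2r leq_addl.
have [fN|fN] := eqVneq (f (- 1)) 0.
  apply: leq_trans (nz_odd _ sgn1 fN f1) _.
  by rewrite leq_add2r leq_addr.
(* Each class contributes at least [q - r] nonzero entries, and [2(q-r) + 2 r./2 >= q + 1] because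
   [r <= q - 2]. *)
have := nz_size _ sgn1 f1; have := nz_size _ sgnN fN.
move: (f_size 1) (f_size (- 1)); move: (size (f 1)) (size (f (- 1))).
by move: #|nz 1| #|nz (- 1)| => x y s t; lia.
Qed.

(** Any [r] other points of the sign class of [i] do: a polynomial of degree less than [r] vanishing
    there is zero. The class has [q - 2 >= r] other points. *)
Lemma recovery_C i : exists2 R, recovery_set C i R & (#|R| <= r)%N.
Proof.
have [e he ie] := sign_classP i.
pose R := [set j in take r (enum (sign_class e :\ i))].
have cardR : #|R| = r.
  rewrite cardsE (card_uniqP _) ?take_uniq ?enum_uniq // size_take_min -cardE.
  have h : #|sign_class e :\ i|.+1 = (q - 1)%N.
    by rewrite -(card_sign_class he) [RHS](cardsD1 i) ie.
  by apply/minn_idPl; rewrite -ltnS h; lia.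
have R_half j : j \in R -> (j != i) && (j \in sign_class e).
  by rewrite inE => /mem_take; rewrite mem_enum in_setD1.
exists R; last by rewrite cardR.
apply/recovery_setP; split=> [|c cC c0].
  by apply/negP => /R_half; rewrite eqxx.
have [f f_size fE] := sign_class_polynomial e cC.
have [f0|/(card_nonroots R P_uniq)] := eqVneq f 0.
  by apply/eqP; rewrite -(fmorph_eq0 iota) fE // f0 horner0.
rewrite cardR (_ : [set _ in R | _] = set0).
  by rewrite cards0 add0n ltnNge f_size.
apply/setP => j; rewrite in_set0; apply/negP; rewrite in_set => /andP[jR].
by case/andP: (R_half j jR) => _ jh; rewrite rootE -fE // c0 // rmorph0 eqxx.
Qed.

Lemma recovery_C_min i R : recovery_set C i R -> (r <= #|R|)%N.
Proof.
case/recovery_setP=> iR vanish; rewrite leqNgt; apply/negP => R_lt.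
have card_KF : #|K| = (#|F| ^ 2)%N by rewrite card_F.
have [w [w_inj w_surj]] := frobenius_closed_decomposition iota card_KF frobenius_E.
(* The degree of [h] is [#|R| < r], so its evaluation lies in [E], and it vanishes exactly on
   [R]. *)
pose h := \prod_(j in R) ('X - (tnth P j)%:P).
pose e : 'rV_n := \row_i h.[tnth P i].
have eE : e \in E.
  apply/mem_evalP; exists h, 0; split=> [||a _|j]; rewrite ?size_poly0 ?coef0 //.
    by rewrite /h -big_enum size_prod_XsubC -cardE.
  by rewrite mxE horner0 mulr0 addr0.
have e_eq0 j : (e 0 j == 0) = (j \in R).
  rewrite mxE horner_prod prodf_seq_eq0; apply/hasP/idP => [[k _ /andP[kR]]|jR].
    by rewrite hornerXsubC subr_eq0 => /eqP/(tuple_uniqP _ P_uniq)->.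
  by exists j; rewrite ?mem_index_enum // jR hornerXsubC subrr eqxx.
have [c [c' [cC c'C ec]]] := w_surj e eE.
(* Both components of [e] vanish on [R], hence at [i] by recovery; then [e] would vanish at [i],
   which is outside [R]. *)
have cc0 j : j \in R -> c 0 j = 0 /\ c' 0 j = 0.
  rewrite -e_eq0 ec => /eqP ej; apply: w_inj.
  by move: ej; rewrite !mxE => ->; rewrite rmorph0 mulr0 addr0.
case/negP: iR; rewrite -e_eq0 ec !mxE !vanish ?rmorph0 ?mulr0 ?addr0 // => j jR.
  by case: (cc0 j jR).
by case: (cc0 j jR).
Qed.

(** The sign class of [i] has [q - 1 = r + (q - r) - 1] points, of which at most [r - 1] are roots
    of the polynomial. *)
Lemma locality_C : has_locality C r (q - r).
Proof.
move=> i; have [e he ie] := sign_classP i.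
exists (sign_class e); split=> //; first by rewrite card_sign_class //; lia.
apply: leq_min_distance_proj => [|c cC [j je cj]].
  by rewrite card_sign_class //; lia.
have [f f_size fE] := sign_class_polynomial e cC.
have f0 : f != 0.
  by apply: contra cj => /eqP f0; rewrite -(fmorph_eq0 iota) fE // f0 horner0.
have := card_nonroots (sign_class e) P_uniq f0; rewrite card_sign_class //.
rewrite (_ : [set _ in _ | _] = [set k in sign_class e | c 0 k != 0]).
  by move: f_size; move: #|pred_of_set _| (size f) => x s; lia.
apply/setP => k; rewrite !in_set; apply: andb_id2l => ke.
by rewrite rootE -fE ?inE // fmorph_eq0.
Qed.

Lemma sharp_C : sharp_LRC C.
Proof.
have n_gt0 : (0 < n)%N by rewrite length_roots; lia.
have r_lt : (r < n)%N by rewrite length_roots; lia.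
split=> [i|]; first by have [R] := recovery_C i; exists R.
rewrite (min_distance_dual n_gt0 r_lt recovery_C recovery_C_min) subn1.
exact: classical_localityE recovery_C recovery_C_min.
Qed.

(** Ensures that no projection to a nonempty set is zero, so that its minimum distance is at most
    its length. *)
Lemma all_ones_C : const_mx 1 \in C.
Proof.
rewrite mem_subfield_subcode; apply/mem_evalP; exists 1, 0.
split=> [||a _|i]; rewrite ?size_poly1 ?size_poly0 ?coef0 //.
by rewrite !mxE rmorph1 hornerC horner0 mulr0 addr0.
Qed.

(** Below, distance [q - r] forces length at least [q - r]; above, the sign classes are admissible.
    These bounds suffice for the defect. *)
Lemma t_locality_C :
  exists2 rho : nat, t_locality C (q - r - 1) = rho%:Z - 1 & (q - r <= rho <= q - 1)%N.
Proof.
have tE : (q - r - 1).+1 = (q - r)%N by lia.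
eexists; first by []; apply/andP; split.
  apply: leq_bigmin => [|rho]; first by rewrite length_roots; lia.
  have n_gt0 : (0 < n)%N by rewrite length_roots; lia.
  move/forallP/(_ (Ordinal n_gt0))/existsP => [R /and3P[iR le_R]].
  rewrite tE => /leq_trans-> //; apply: leq_trans le_R.
  by apply: min_distance_proj_leq all_ones_C iR _; rewrite mxE oner_eq0.
have q_lt : (q - 1 < n.+1)%N by rewrite length_roots; lia.
apply: (@bigmin_leq _ _ (fun rho : 'I_n.+1 => rho : nat) _ (Ordinal q_lt)).
apply/forallP => i; have [R [iR le_R dR]] := locality_C i.
apply/existsP; exists R; rewrite iR tE dR /= andbT.
by apply: leq_trans le_R _; lia.
Qed.

Lemma singleton_defect_C : (1 < r)%N ->
  singleton_defect C (q - r - 1) <= (uphalf r)%:Z + 2 * (r./2%:Z - 1) + 1 - r%:Z.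
Proof.
move=> r_gt1; rewrite /singleton_defect dim_C.
have [rho -> /andP[rho_ge rho_le]] := t_locality_C.
set t := (q - r - 1)%N; set x := Num.ceil _.
(* The denominator [rho - t] lies between 1 and [r], while the dimension [r + r./2] exceeds [r] once
   [r > 1]; the quotient is thus greater than 1. *)
have x_ge2 : 2 <= x.
  have den_gt0 : 0 < rho%:Z - 1 - t%:Z + 1 by lia.
  rewrite -[2]/(1 + 1) lezD1 real_ceil_gt_int ?num_real //.
  by rewrite ltr_pdivlMr ?ltr0z // mul1r ltr_int; lia.
have xt : 2 * t%:Z <= x * t%:Z by rewrite ler_wpM2r.
have := min_distance_C; have := length_roots; have := uphalf_half r.
have := odd_double_half r.
by move: (min_distance C) => d; lia.
Qed.

End TwoHalves.

(** * Rational rounding in terms of halves, and the final assembly *)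

Lemma ceil_half (r : nat) : Num.ceil (r%:Q / 2) = (uphalf r)%:Z.
Proof.
have rE : r%:Q = (odd r)%:R + 2 * (r./2)%:R.
  by rewrite -pmulrn -{1}(odd_double_half r) natrD -mul2n natrM.
apply: ceil_def; rewrite uphalf_half rE rmorphB /= -!pmulrn natrD.
by case: (odd r) => /=; rewrite ?mulr1n ?mulr0n; lra.
Qed.

Lemma floor_half_sub1 (r : nat) : Num.floor ((r%:Q - 2) / 2) = r./2%:Z - 1.
Proof.
have rE : r%:Q = (odd r)%:R + 2 * (r./2)%:R.
  by rewrite -pmulrn -{1}(odd_double_half r) natrD -mul2n natrM.
apply: floor_def; rewrite rE subrK rmorphB /= -!pmulrn.
by case: (odd r) => /=; rewrite ?mulr1n ?mulr0n; lra.
Qed.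

Theorem theorem2p15 (Fq FQ : finFieldType) (iota : {rmorphism Fq -> FQ})
    (q N1 n r : nat) (P : n.-tuple FQ)
    (card_Fq : #|Fq| = q) (card_FQ : #|FQ| = (q ^ 2)%N) (q_odd : odd q)
    (N1_def : N1 = (2 * (q - 1) + 1)%N)
    (P_uniq : uniq P)
    (P_roots : forall x : FQ, (x \in P) = root ('X^(N1 - 1) - 1) x)
    (r_gt0 : (0 < r)%N) (r_le : (r <= q - 2)%N) :
  let Delta := \bigcup_(a < N1 - 1 | (a < r)%N) cyclotomic_set q a in
  let C := subfield_subcode iota (eval_code P Delta) in
  [/\ n = (2 * (q - 1))%N
      /\ (\dim C)%:Z = 2 * r%:Z - Num.ceil (r%:Q / 2),
      (min_distance C)%:Z
        >= (q%:Z - 1) - 2 * Num.floor ((r%:Q - 2) / 2),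
      sharp_LRC C,
      has_locality C r (q - r)
    & (1 < r)%N ->
      singleton_defect C (q - r - 1)
        <= Num.ceil (r%:Q / 2) + 2 * Num.floor ((r%:Q - 2) / 2) + 1 - r%:Z].
Proof.
have N_def : (N1 - 1 = 2 * (q - 1))%N by lia.
move=> Delta C; rewrite ceil_half floor_half_sub1.
have dimC : \dim C = (r + r./2)%N by apply: dim_C.
have dC : (q + 1 <= min_distance C + 2 * r./2)%N by apply: min_distance_C.
split.
- split.
    rewrite -N_def.
    exact: length_roots card_Fq card_FQ q_odd N_def P_uniq P_roots r_gt0 r_le.
  by rewrite dimC uphalf_half; have := odd_double_half r; lia.
- by move: (min_distance C) dC => d; lia.
- exact: sharp_C.
- exact: locality_C.
exact: singleton_defect_C.
Qed.
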